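(* For every real number $d$ with $0\leq d\leq 1$, there exists a sequence $\mathbf{r}=(r_n)_{n=1}^\infty$ of positive integers with $r_n\to\infty$ as $n\to\infty$ such that $$\dim_{\mathrm H} E(\mathbf{r})=\underline{\dim}_{\mathrm{MB}} E(\mathbf{r})=d.$$
   Context: For a sequence $\mathbf{r}=(r_n)_{n=1}^\infty$ of positive real numbers with $r_n\to\infty$, $$E(\mathbf{r})=\{x\in\mathbb{R} : (r_nx)_{n=1}^\infty \text{ is not dense modulo } 1\},$$ where a sequence of reals is dense modulo 1 if the sequence of its images in $\mathbb{R}/\mathbb{Z}$ is dense in $\mathbb{R}/\mathbb{Z}$. $\dim_{\mathrm H}$ denotes Hausdorff dimension. For a non-empty bounded set $F\subseteq\mathbb{R}$ and $\varepsilon>0$, let $N_\varepsilon(F)$ be the smallest number of sets of diameter at most $\varepsilon$ which can cover $F$. The lower box dimension of $F$ is $\underline{\dim}_{\mathrm B}F=\liminf_{\varepsilon\to0}\frac{\log N_\varepsilon(F)}{-\log\varepsilon}$. For $F\subseteq\mathbb{R}$, the modified lower box dimension is $$\underline{\dim}_{\mathrm{MB}}F=\inf\Big\{\sup_i\underline{\dim}_{\mathrm B}F_i : F\subseteq\bigcup_{i=1}^\infty F_i\Big\},$$ the infimum being over all countable covers $\{F_i\}_{i=1}^\infty$ of $F$ by non-empty bounded sets. *)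

(* Defs.v *)
From HB Require Import structures.
From mathcomp Require Import all_boot all_order all_algebra ring_quotient.
From mathcomp Require Import all_classical all_reals all_analysis.

Set Implicit Arguments.
Unset Strict Implicit.
Unset Printing Implicit Defensive.

Import Order.TTheory GRing.Theory Num.Theory.
Import numFieldNormedType.Exports.

Local Open Scope classical_set_scope.
Local Open Scope ring_scope.
Local Open Scope ereal_scope.

(* Num.int_num_subdef is the predicate behind the qualifier Num.int. *)
Definition int_subgroup (R : realType) : zmodClosed R :=
  GRing.ZmodClosed.clone R (@Num.int_num_subdef R) _.

Definition RmodZ (R : realType) :=
  quotient_topology (Quotient.quot (int_subgroup R)).

Definition mod1 (R : realType) (x : R) : RmodZ R := (\pi_(RmodZ R) x)%qT.

Definition dense_mod1 (R : realType) (u : nat -> R) : Prop :=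
  dense (range (fun n => mod1 (u n))).

(* Sequences are indexed from 0: r n is the (n+1)-st term. *)
Definition nondense_set (R : realType) (r : nat -> R) : set R :=
  [set x | ~ dense_mod1 (fun n => r n * x)%R].

(* The diameter of the empty set is -oo with this definition. *)
Definition diam (R : realType) (A : set R) : \bar R :=
  ereal_sup [set `|x - y|%:E | x in A & y in A].

(* Finite covers are covers by sequences that are eventually empty; the empty
   sets are left out of the sum (otherwise they would contribute 1 when
   s = 0), and a nonempty set of diameter 0 contributes 0 `^ 0 = 1 when
   s = 0. *)
Definition hausdorff_premeasure (R : realType) (s delta : R) (F : set R) :
    \bar R :=
  ereal_inf [set \sum_(0 <= i <oo | U i != set0) poweR (diam (U i)) s
            | U in [set U : nat -> set R |
                     (forall i, diam (U i) <= delta%:E) /\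
                     F `<=` \bigcup_i U i]].

Definition hausdorff_measure (R : realType) (s : R) (F : set R) : \bar R :=
  ereal_sup [set hausdorff_premeasure s delta F
            | delta in [set delta | (0 < delta)%R]].

Definition hausdorff_dim (R : realType) (F : set R) : \bar R :=
  ereal_inf [set s%:E | s in [set s : R |
    (0 <= s)%R /\ hausdorff_measure s F = 0]].

Definition coverable (R : realType) (e : R) (F : set R) (n : nat) : Prop :=
  exists U : 'I_n -> set R,
    (forall i, diam (U i) <= e%:E) /\ F `<=` \bigcup_i U i.

(* The value is 0 when no finite cover exists, which happens for no bounded F
   and positive e. *)
Definition covering_number (R : realType) (e : R) (F : set R) : nat :=
  xget 0%N [set n | coverable e F n /\
                    forall m, coverable e F m -> (n <= m)%N].

Definition lower_box_dim (R : realType) (F : set R) : \bar R :=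
  limf_einf (fun e : R => (ln (covering_number e F)%:R / - ln e)%R%:E) (0^'+)%R.

Definition modified_lower_box_dim (R : realType) (F : set R) : \bar R :=
  ereal_inf [set ereal_sup (range (fun i => lower_box_dim (G i)))
            | G in [set G : nat -> set R |
                     (forall i, G i !=set0 /\ bounded_set (G i)) /\
                     F `<=` \bigcup_i G i]].

(* Main.v *)
Require Import Defs.
From mathcomp Require Import all_boot all_order all_algebra ring_quotient.
From mathcomp Require Import all_classical all_reals all_analysis.
From mathcomp Require Import ring lra zify.

Set Implicit Arguments.
Unset Strict Implicit.
Unset Printing Implicit Defensive.

Import Order.TTheory GRing.Theory Num.Theory.
Import numFieldNormedType.Exports.

Local Open Scope classical_set_scope.
Local Open Scope ring_scope.

(** Fix positive integers D_k, M_k, put B_k = 2 M_k D_k and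
    q_k = B_0 ... B_(k-1), and let r enumerate the numbers m q_k with
    1 <= m <= M_k.  The size of E(r) is governed by the size of D_k relative
    to B_k.

    If x is in E(r), then for some Q an arc of length 1/Q is missed by all
    m q_k x with m <= M_k.  By Dirichlet's theorem some multiple s q_k x with
    s <= Q lies within 1/Q of an integer, and its own multiples then walk along
    the circle with steps too short to jump over the arc, unless the walk ends
    before one turn: s q_k x is within 2 Q / M_k of an integer
    ([multiples_hit_arc_or_near_rational]).  With L = Q! independent of k, every
    L q_k x is within c / M_k of an integer, so that an interval allowed at
    level k contains O(D_k) allowed intervals of level k + 1.  Hence E(r) lies
    in a countable union of sets covered by O(C^k D_0 ... D_(k-1)) intervals of
    length about 1 / q_k ([covering_number_near_multiples]).

    Conversely a number x = sum_k b_k / q_(k+1) with digits 0 <= b_k < D_k has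
    q_k x in [0, 1 / (2 M_k)] modulo 1, so that no m q_k x with m <= M_k enters
    ]1/2, 1[.  Sending the number y of [0, 1[ with digits b_k in the radices D_k
    to the number x with the same digits in the radices B_k gives, if
    D_0 ... D_(k-1) is unbounded, an injection of [0, 1[ into E(r).  Its
    inverse is Hoelder of exponent s as soon as
    q_(k+1)^s = O(D_0 ... D_(k-1)), so that the covers of E(r) are bounded below
    through the Lebesgue measure of [0, 1[ ([cantor_map_separates],
    [hausdorff_measure_neq0]).

    With D_k = 2^f, M_k = 2^(k - f), f = floor (d k), one gets
    q_k = 2^(k(k+1)/2) and D_0 ... D_(k-1) = 2^(d k^2 / 2 + O(k)).  The
    logarithms are quadratic in k, the factor C^k and the shift from k to k + 1
    change them by linear terms only, and both estimates give the exponent d: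
    d <= dim_H E(r) and dim_MB E(r) <= d.  The inequality dim_H <= dim_MB holds
    for all sets ([hausdorff_dim_le_modified_lower_box_dim]). *)

(** * Density modulo one *)

Lemma mod1_eqP (R : realType) (x y : R) :
  mod1 x = mod1 y <-> exists p : int, x - y = p%:~R.
Proof.
have E := Quotient.idealrBE (int_subgroup R) x y.
have intE : (x - y \in int_subgroup R) = (x - y \is a Num.int) by [].
split=> [xy|/intrP]; first by apply/intrP; rewrite -intE E; apply/eqP.
by rewrite -intE E => /eqP.
Qed.

(** Open sets of the quotient are the sets with open preimage, so that density
    can be tested on translates of intervals. *)
Lemma nondense_mod1P (R : realType) (u : nat -> R) :
  ~ dense_mod1 u <->
  exists a e : R, 0 < e /\ forall n (p : int), e <= `|u n - a - p%:~R|.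
Proof.
split=> [nd|[a [e [e0 H]]] dn].
  apply: contrapT => H; apply: nd => O [z Oz] oO.
  pose a : R := repr z.
  have am : mod1 a = z by exact: reprK.
  have /nbhs_ballP[e /= e0 ae] : nbhs a ((fun x : R => mod1 x) @^-1` O).
    by apply: open_nbhs_nbhs; split; [exact: oO|rewrite /= am].
  apply: contrapT => nO; apply: H; exists a, e; split=> // n p.
  rewrite leNgt; apply/negP => upe; apply: nO.
  exists (mod1 (u n)); split; last by exists n.
  have -> : mod1 (u n) = mod1 (u n - p%:~R).
    by apply/mod1_eqP; exists p; ring.
  apply: ae; rewrite -ball_normE /= distrC.
  by rewrite (_ : _ - _ - _ = u n - a - p%:~R)//; ring.
(* The image of the interval ]a - e, a + e[; its preimage is the union of the
   integer translates of the interval. *)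
pose O : set (RmodZ R) := [set z | exists2 x : R, `|x - a| < e & mod1 x = z].
have oO : open O.
  rewrite -[open _]/(open ((fun x : R => mod1 x) @^-1` O)).
  rewrite openE => y [x xa /mod1_eqP[p pE]].
  apply/nbhs_ballP; exists (e - `|x - a|) => /=; first by rewrite subr_gt0.
  move=> z; rewrite -ball_normE /= => yz; exists (z + p%:~R); last first.
    by apply/mod1_eqP; exists p; ring.
  have -> : z + p%:~R - a = (x - a) - (y - z) by rewrite -pE; ring.
  by rewrite (le_lt_trans (ler_normB _ _))// -ltrBrDl.
have [|z [[x xa <-] [n _ /mod1_eqP[p pE]]]] := dn O _ oO.
  by exists (mod1 a), a => //; rewrite subrr normr0.
have := H n p; rewrite leNgt => /negP; apply.
by rewrite (_ : _ - _ - _ = x - a)// -pE; ring.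
Qed.

(** * Multiples of a real number modulo one *)

(** Pigeonhole: two of the fractional parts of 0, y, ..., Q y fall into the same
    of the Q cells of length 1/Q. *)
Lemma dirichlet_approx (R : realType) (y : R) (Q : nat) : (0 < Q)%N ->
  exists q (p : int), (0 < q <= Q)%N /\ `|q%:R * y - p%:~R| <= Q%:R^-1.
Proof.
move=> Q0; have Q0' : 0 < Q%:R :> R by rewrite ltr0n.
pose t (i : nat) : R := i%:R * y - (Num.floor (i%:R * y))%:~R.
have t01 i : 0 <= t i < 1.
  have := floor_itv (i%:R * y : R); rewrite /t intrD => /andP[? ?].
  by apply/andP; split; lra.
have cellP i : (Num.truncn (Q%:R * t i) < Q)%N.
  have /andP[t0 t1] := t01 i.
  rewrite truncn_lt_nat ?mulr_ge0 ?ler0n//.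
  by rewrite -[ltRHS]mulr1 ltr_pM2l.
pose cell (i : 'I_Q.+1) : 'I_Q := Ordinal (cellP i).
have [i [j [ij cellij]]] : exists i j : 'I_Q.+1, (i < j)%N /\ cell i = cell j.
  have /injectivePn[i [j ij cij]] : ~~ injectiveb cell.
    by apply/negP => /injectiveP/leq_card; rewrite !card_ord ltnn.
  have [lt|lt] := ltnP i j; [by exists i, j|exists j, i; split=> //].
  by rewrite ltn_neqAle lt andbT eq_sym.
have close : `|t j - t i| <= Q%:R^-1.
  have b k := truncn_itv (mulr_ge0 (ler0n R Q) (andP (t01 k)).1).
  have := b i; have := b j.
  have -> : Num.truncn (Q%:R * t j) = Num.truncn (Q%:R * t i).
    by have [] := cellij.
  set n := Num.truncn _; rewrite -natr1 => /andP[? ?] /andP[? ?].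
  rewrite -(ler_pM2l Q0') mulfV ?gt_eqF// -[X in X * _]gtr0_norm// -normrM.
  by rewrite ler_norml; apply/andP; split; lra.
exists (j - i)%N, (Num.floor (j%:R * y : R) - Num.floor (i%:R * y : R)).
split; first by have := ltn_ord j; lia.
rewrite natrB 1?ltnW// intrB (le_trans _ close)//.
by rewrite (_ : _ - _ = t j - t i)// /t; ring.
Qed.

(** The multiples of th advance by steps not longer than the arc, and they make
    a full turn before the index J. *)
Lemma multiples_hit_arc_pos (R : realType) (th a w : R) (J : nat) :
  0 < th -> th <= w -> 1 < J%:R * th ->
  exists j (p : int), (0 < j <= J)%N /\ a <= j%:R * th - p%:~R <= a + w.
Proof.
move=> th0 thw Jth.
pose b := a - (Num.floor a)%:~R.
have /andP[b0 b1] : 0 <= b < 1.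
  have := floor_itv a; rewrite intrD => /andP[? ?].
  by apply/andP; split; rewrite /b; lra.
have /andP[n1 n2] := truncn_itv (divr_ge0 b0 (ltW th0)).
set n := Num.truncn _ in n1 n2.
move: n1 n2; rewrite ler_pdivlMr// ltr_pdivrMr// => n1 n2.
exists n.+1, (- Num.floor a); split.
  rewrite /= -(ltr_nat R) -(ltr_pM2r th0); lra.
move: n2; rewrite -natr1 intrN => n2.
by rewrite /b in n1 n2; apply/andP; split; lra.
Qed.

Lemma multiples_hit_arc (R : realType) (th a w : R) (J : nat) :
  `|th| <= w -> 1 < J%:R * `|th| ->
  exists j (p : int), (0 < j <= J)%N /\ a <= j%:R * th - p%:~R <= a + w.
Proof.
have [th0|th0|->] := ltgtP th 0 => thw Jth; first last.
- by move: Jth; rewrite normr0; lra.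
- by apply: multiples_hit_arc_pos => //; rewrite gtr0_norm// in thw Jth *.
rewrite ltr0_norm// in thw Jth.
have th0' : 0 < - th by lra.
have [j [p [jJ /andP[? ?]]]] := multiples_hit_arc_pos (- a - w) th0' thw Jth.
exists j, (- p); split=> //; rewrite intrN.
by apply/andP; split; lra.
Qed.

(** The walk is made by the multiples of the number th = q y - p supplied by
    Dirichlet's theorem; M %/ Q of its steps use multipliers of y up to M. *)
Lemma multiples_hit_arc_or_near_rational (R : realType) (y a : R) (M Q : nat) :
  (0 < Q)%N -> (0 < M)%N ->
  (exists m (p : int),
     (0 < m <= M)%N /\ a <= m%:R * y - p%:~R <= a + Q%:R^-1) \/
  (exists q (p : int),
     (0 < q <= Q)%N /\ `|q%:R * y - p%:~R| <= 2 * Q%:R / M%:R).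
Proof.
move=> Q0 M0; have [q [p [qQ qyp]]] := dirichlet_approx y Q0.
have Q0' : 1 <= Q%:R :> R by rewrite ler1n.
have M0' : 0 < M%:R :> R by rewrite ltr0n.
set th := q%:R * y - p%:~R in qyp.
have [small|large] := leP `|th| (2 * Q%:R / M%:R); first by right; exists q, p.
(* M < Q would give |th| <= 1 < 2 Q / M. *)
left; have QM : (Q <= M)%N.
  rewrite leqNgt; apply/negP => MQ.
  have : `|th| <= 1 by rewrite (le_trans qyp)// invf_le1//; lra.
  apply/negP; rewrite -ltNge (le_lt_trans _ large)//.
  rewrite ler_pdivlMr// mul1r.
  have : M%:R <= Q%:R :> R by rewrite ler_nat ltnW.
  lra.
have M2J : (M <= 2 * Q * (M %/ Q))%N.
  have := divn_eq M Q; have := ltn_pmod M Q0.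
  have : (0 < M %/ Q)%N by rewrite divn_gt0.
  nia.
have Jth : 1 < (M %/ Q)%:R * `|th|.
  have J0 : 0 < (M %/ Q)%:R :> R by rewrite ltr0n divn_gt0.
  rewrite (le_lt_trans _ (_ : (M %/ Q)%:R * (2 * Q%:R / M%:R) < _))//.
    rewrite mulrA ler_pdivlMr// mul1r -!natrM ler_nat; lia.
  by rewrite ltr_pM2l.
have [j [p' [jJ H]]] := multiples_hit_arc a qyp Jth.
exists (j * q)%N, (j%:Z * p + p'); split.
  have := leq_trunc_div M Q; have : (0 < j * q)%N.
    by case/andP: jJ; case/andP: qQ; lia.
  by case/andP: jJ; case/andP: qQ; nia.
suff -> : (j * q)%:R * y - (j%:Z * p + p')%:~R = j%:R * th - p'%:~R by [].
rewrite /th natrM intrD intrM -pmulrn; ring.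
Qed.

(** * Enumerating the multiples of a sequence *)

(** Decoding is by [pickle_inv], not [unpickle]: each pair then comes from a
    single index, without which the sequence need not tend to infinity. *)
Definition multiples_seq (q M : nat -> nat) (n : nat) : nat :=
  if pickle_inv n is Some (k, m) then
    if (0 < m <= M k)%N then (m * q k)%N else q n
  else q n.

Lemma multiples_seq_mem (q M : nat -> nat) (n : nat) :
  (forall k, 0 < M k)%N ->
  exists k m, (0 < m <= M k)%N /\ multiples_seq q M n = (m * q k)%N.
Proof.
move=> M0; rewrite /multiples_seq; case: pickle_inv => [[k m]|].
  by case: ifP => mM; [exists k, m|exists n, 1%N; rewrite M0 mul1n].
by exists n, 1%N; rewrite M0 mul1n.
Qed.

Lemma mem_multiples_seq (q M : nat -> nat) (k m : nat) :
  (0 < m <= M k)%N -> exists n, multiples_seq q M n = (m * q k)%N.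
Proof.
by move=> mM; exists (pickle (k, m)); rewrite /multiples_seq pickleK_inv mM.
Qed.

Lemma multiples_seq_cvgy (R : realType) (q M : nat -> nat) :
  (forall k, k < q k)%N ->
  (multiples_seq q M n)%:R @[n --> \oo] --> (+oo : set_system R).
Proof.
move=> q_gt; apply/cvgrnyP/cvgnyPge => A.
(* Past B no index encodes a pair (k, m) with k, m <= A. *)
pose B := (A + \max_(k < A.+1) \max_(m < A.+1) pickle (val k, val m))%N.
exists B.+1 => // n /= Bn; rewrite leqNgt; apply/negP.
have nA : ~ (q n < A)%N by have := q_gt n; lia.
rewrite /multiples_seq; case E : pickle_inv => [[k m]|//].
case: ifP => // mM mqA.
have kA : (k < A.+1)%N by have := q_gt k; case/andP: mM; nia.
have mA : (m < A.+1)%N by have := q_gt k; case/andP: mM; nia.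
have nE : n = pickle (k, m).
  by have := @pickle_invK (nat * nat)%type n; rewrite E.
have : (n <= \max_(k < A.+1) \max_(m < A.+1) pickle (val k, val m))%N.
  rewrite nE (leq_trans _ (leq_bigmax (Ordinal kA)))//=.
  by rewrite (leq_trans _ (leq_bigmax (Ordinal mA)))//=.
by move: Bn; rewrite /B; lia.
Qed.

(** The hypothesis keeps m q_k x in [0, 1/2] modulo 1 for every m <= M_k, away
    from the arc centred at 3/4. *)
Lemma nondense_multiples (R : realType) (q M : nat -> nat) (x : R) :
  (forall k, 0 < M k)%N ->
  (forall k, exists p : int, 0 <= (q k)%:R * x - p%:~R <= (2 * M k)%:R^-1) ->
  nondense_set (fun n => (multiples_seq q M n)%:R : R) x.
Proof.
move=> M0 H; apply/nondense_mod1P; exists (3 / 4), (1 / 4); split; first by lra.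
move=> n p; have [k [m [/andP[m0 mM] ->]]] := multiples_seq_mem q n M0.
have [p' /andP[]] := H k.
set t := _ * x - _ => t0.
rewrite -[_^-1]mul1r ler_pdivlMr ?ltr0n ?muln_gt0 ?M0//.
rewrite natrM => tM.
have mM' : m%:R <= (M k)%:R :> R by rewrite ler_nat.
have /andP[mt0 mt1] : 0 <= m%:R * t <= 1 / 2.
  by rewrite mulr_ge0 ?ler0n//=; nra.
have -> : (m * q k)%:R * x - 3 / 4 - p%:~R
    = m%:R * t - 3 / 4 - (p - m%:Z * p')%:~R.
  by rewrite /t natrM intrB intrM -pmulrn; ring.
have [zle|zge] := lerP (p - m%:Z * p') (-1).
  rewrite -(ler_int R) intrN in zle.
  by rewrite ler_normr; apply/orP; left; lra.
have {}zge : 0 <= p - m%:Z * p' by lia.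
rewrite -(ler_int R) in zge.
by rewrite ler_normr; apply/orP; right; lra.
Qed.

Definition near_multiples_set (R : realType) (q M : nat -> nat) (L c A : nat) :
    set R :=
  [set x | `|x| <= A%:R /\
           forall k, exists p : int,
             `|(L * q k)%:R * x - p%:~R| <= c%:R / (M k)%:R].

(** The denominator s <= i + 1 of the rational near q_k x depends on k; the
    factorial is a common multiple of all of them.  This makes countably many
    sets, of one parameter i, sufficient to cover E(r). *)
Lemma near_multiples_of_nondense (R : realType) (q M : nat -> nat) (x : R) :
  (forall k, 0 < M k)%N ->
  nondense_set (fun n => (multiples_seq q M n)%:R : R) x ->
  exists i : nat,
    near_multiples_set q M i.+1`! (i.+1`! * (2 * i.+1)) i.+1 x.
Proof.
move=> M0 /nondense_mod1P[a [e [e0 H]]].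
pose i := (Num.truncn (e^-1) + Num.truncn `|x|)%N; exists i; split.
  rewrite (le_trans (ltW (truncnS_gt _)))// ler_nat ltnS; exact: leq_addl.
have ie : i.+1%:R^-1 < e.
  rewrite invf_plt ?posrE ?ltr0Sn// (lt_le_trans (truncnS_gt _))// ler_nat ltnS.
  exact: leq_addr.
move=> k.
have [[m [p [mM mp]]]|[s [p [sQ sp]]]] :=
  multiples_hit_arc_or_near_rational ((q k)%:R * x) a (ltn0Sn i) (M0 k).
  have [n nE] := mem_multiples_seq q mM.
  have := H n p; rewrite nE natrM -mulrA leNgt ltr_norml => /negP[].
  by case/andP: mp; move: ie; set w := _^-1 => ? ? ?; apply/andP; split; lra.
have /dvdnP[l lE] : (s %| i.+1`!)%N by rewrite dvdn_fact.
exists (l%:Z * p).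
have -> : (i.+1`! * q k)%:R * x - (l%:Z * p)%:~R
    = l%:R * (s%:R * ((q k)%:R * x) - p%:~R).
  by rewrite lE !natrM intrM -pmulrn; ring.
rewrite normrM normr_nat (natrM _ _ (2 * _)) (natrM _ 2) -mulrA.
apply: ler_pM => //.
by rewrite ler_nat lE leq_pmulr//; case/andP: sQ.
Qed.

(** * Covering numbers and the lower box dimension *)

Lemma diam_ge0 (R : realType) (U : set R) : U !=set0 -> (0 <= diam U)%E.
Proof.
move=> [x Ux]; apply: ereal_sup_ubound; exists x => //; exists x => //.
by rewrite subrr normr0.
Qed.

Lemma dist_le_diam (R : realType) (U : set R) (x y : R) :
  U x -> U y -> (`|x - y|%:E <= diam U)%E.
Proof. by move=> Ux Uy; apply: ereal_sup_ubound; exists x => //; exists y. Qed.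

Lemma coverable_near_seq (R : realType) (e : R) (F : set R) (s : seq R) :
  (forall x, F x -> exists2 t, t \in s & `|x - t| <= e / 2) ->
  coverable e F (size s).
Proof.
move=> H; exists (fun i => [set x | `|x - s`_i| <= e / 2]); split=> [i|x Fx].
  apply: ge_ereal_sup => _ [x /= xi [y /= yi <-]]; rewrite lee_fin.
  have -> : x - y = (x - s`_i) - (y - s`_i) by ring.
  by rewrite (le_trans (ler_normB _ _))//; lra.
have [t ts xt] := H x Fx; have it : (index t s < size s)%N by rewrite index_mem.
by exists (Ordinal it) => //=; rewrite nth_index.
Qed.

Lemma covering_number_le (R : realType) (e : R) (F : set R) (n : nat) :
  coverable e F n -> (covering_number e F <= n)%N.
Proof.
rewrite /covering_number; case: xgetP => [m -> [_ min]|_] nF; first exact: min.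
exact: leq0n.
Qed.

Lemma coverable_covering_number (R : realType) (e : R) (F : set R) :
  (exists n, coverable e F n) -> coverable e F (covering_number e F).
Proof.
move=> [n nF]; rewrite /covering_number; case: xgetP => [m -> []//|nex].
have ex : exists k, `[< coverable e F k >] by exists n; apply/asboolP.
exfalso; apply: (nex (ex_minn ex)); case: ex_minnP => k /asboolP kF min.
by split=> // m mF; apply: min; apply/asboolP.
Qed.

Definition ints_around (R : realType) (t : R) (J : nat) : seq int :=
  [seq Num.floor t - J%:Z + i%:Z | i <- iota 0 (2 * J).+1].

Lemma mem_ints_around (R : realType) (t : R) (J : nat) (p : int) :
  `|p%:~R - t| <= J%:R -> p \in ints_around t J.
Proof.
rewrite ler_norml => /andP[lo hi].
have p1 : p - J%:Z <= Num.floor t.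
  by rewrite floor_ge_int intrB -pmulrn; lra.
have p2 : Num.floor t <= p + J%:Z.
  rewrite -ltzD1 floor_lt_int !intrD -pmulrn; lra.
apply/mapP; exists (absz (p - (Num.floor t - J%:Z))%R); last by lia.
by rewrite mem_iota; lia.
Qed.

Lemma size_ints_around (R : realType) (t : R) (J : nat) :
  size (ints_around t J) = (2 * J).+1.
Proof. by rewrite size_map size_iota. Qed.

(** Makes the covering number of a bounded set a genuine minimum. *)
Lemma coverable_bounded (R : realType) (e : R) (F : set R) :
  0 < e -> bounded_set F -> exists n, coverable e F n.
Proof.
move=> e0 [M0 [_ /(_ (M0 + 1))]]; rewrite ltrDl ltr01 => /(_ isT) bF.
pose J := (Num.truncn ((M0 + 1) * 2 / e + 1)).+1.
pose s := [seq p%:~R * (e / 2) : R | p <- ints_around (0 : R) J].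
exists (size s); apply: coverable_near_seq => x Fx.
pose p := Num.floor (x / (e / 2)).
have e2 : 0 < e / 2 by lra.
have := floor_itv (x / (e / 2)); rewrite intrD -/p => /andP[].
rewrite ler_pdivlMr// ltr_pdivrMr// => p1 p2.
exists (p%:~R * (e / 2)); last by rewrite ler_norml; apply/andP; split; lra.
apply/mapP; exists p => //; apply: mem_ints_around; rewrite subr0.
have /ltW := truncnS_gt ((M0 + 1) * 2 / e + 1); apply: le_trans.
have : `|x| <= M0 + 1 by exact: bF.
rewrite ler_norml => /andP[x1 x2].
have -> : (M0 + 1) * 2 / e + 1 = ((M0 + 1) + e / 2) / (e / 2).
  by field; rewrite gt_eqF.
by rewrite ler_pdivlMr// -[X in _ * X]gtr0_norm// -normrM ler_norml;
  apply/andP; split; lra.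
Qed.

Lemma lower_box_dim_le (R : realType) (F : set R) (s : R) :
  (forall eta, 0 < eta -> exists2 e, 0 < e < eta &
     ln (covering_number e F)%:R / - ln e <= s) ->
  (lower_box_dim F <= s%:E)%E.
Proof.
move=> H; rewrite /lower_box_dim limf_einfE; apply: ge_ereal_sup => _ [V V0 <-].
have [eta /= eta0 etaV] := V0.
have [e /andP[e0 eeta] es] := H eta eta0.
apply: ge_ereal_inf; exists (ln (covering_number e F)%:R / - ln e)%:E.
  exists e => //; apply: etaV => //=.
  by rewrite sub0r normrN gtr0_norm.
by rewrite lee_fin.
Qed.

Lemma lower_box_dim_lt (R : realType) (F : set R) (s eta : R) :
  (lower_box_dim F < s%:E)%E -> 0 < eta ->
  exists2 e, 0 < e < eta & ln (covering_number e F)%:R / - ln e < s.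
Proof.
rewrite /lower_box_dim limf_einfE => Fs eta0.
set V := [set e : R | 0 < e < eta].
have V0 : nbhs (0 : R)^'+ V.
  by near=> e; rewrite /V /=; apply/andP; split; near: e;
    [exact: nbhs_right_gt|exact: nbhs_right_lt].
have : (ereal_inf [set (ln (covering_number e F)%:R / - ln e)%:E | e in V]
        < s%:E)%E.
  by apply: le_lt_trans Fs; apply: ereal_sup_ubound; exists V.
by move=> /ereal_inf_lt[_ [e Ve <-]]; rewrite lte_fin => es; exists e.
Unshelve. all: by end_near. Qed.

Lemma lower_box_dim_ge0 (R : realType) (F : set R) : (0 <= lower_box_dim F)%E.
Proof.
rewrite leNgt; apply/negP => /(lower_box_dim_lt (s := 0) (eta := 1)) /(_ ltr01).
move=> [e /andP[e0 e1]]; apply/negP; rewrite -leNgt divr_ge0//.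
  by case: (covering_number e F) => [|n]; [rewrite ln0|rewrite ln_ge0// ler1n].
by rewrite oppr_ge0 ln_le0// ltW.
Qed.

(** * The Hausdorff dimension is at most the modified lower box dimension *)

(** The type alias carries the discrete sigma-algebra, for which the outer
    measure [mu_ext] is an infimum over covers by arbitrary sets; the value +oo
    rules out the covers by sets that are too large. *)
Definition power_diam (R : realType) (s delta : R)
    (U : set (g_sigma_algebraType [set: set R])) : \bar R :=
  if U == set0 then 0%E
  else if (diam (U : set R) <= delta%:E)%E then poweR (diam (U : set R)) s
  else +oo%E.

Lemma power_diam_ge0 (R : realType) (s delta : R) (U : set R) :
  (0 <= power_diam s delta U)%E.
Proof.
rewrite /power_diam; case: ifP => // _; case: ifP => // _; exact: poweR_ge0.
Qed.

Lemma hausdorff_premeasureE (R : realType) (s delta : R) :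
  hausdorff_premeasure s delta = mu_ext (power_diam s delta).
Proof.
apply/funext => F.
have sumE (U : nat -> set R) : (forall i, diam (U i) <= delta%:E)%E ->
    (\sum_(0 <= i <oo | U i != set0) poweR (diam (U i)) s =
     \sum_(0 <= i <oo) power_diam s delta (U i))%E.
  move=> dU; rewrite eseries_mkcond; apply: eq_eseriesr => i _.
  by rewrite /power_diam dU; case: eqP.
apply/eqP; rewrite eq_le; apply/andP; split; apply: le_ereal_inf_tmp.
  move=> _ [A [mA FA] <-].
  have [dA|ndA] := pselect (forall i, diam (A i : set R) <= delta%:E)%E.
    rewrite -sumE//; apply: ereal_inf_lbound; exists A => //.
  have [i /negP dAi] : exists i, ~ (diam (A i : set R) <= delta%:E)%E.
    by apply/existsNP.
  rewrite (@nneseries_pinfty _ _ _ i)// ?leey//.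
    by move=> n _; exact: power_diam_ge0.
  rewrite /power_diam (negbTE dAi); case: eqP => // A0.
  case/negP: dAi; by apply: ge_ereal_sup => z [x]; rewrite A0.
move=> _ [U [dU FU] <-]; rewrite sumE//; apply: ereal_inf_lbound.
by exists U => //; split=> // i; exact: sub_sigma_algebra.
Qed.

Lemma hausdorff_premeasure_ge0 (R : realType) (s delta : R) (F : set R) :
  (0 <= hausdorff_premeasure s delta F)%E.
Proof.
by rewrite hausdorff_premeasureE mu_ext_ge0// => ?; exact: power_diam_ge0.
Qed.

(** Countable subadditivity of the outer measure. *)
Lemma hausdorff_premeasure_bigcup_eq0 (R : realType) (s delta : R)
    (F : set R) (G : nat -> set R) : F `<=` \bigcup_i G i ->
  (forall i, hausdorff_premeasure s delta (G i) = 0%E) ->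
  hausdorff_premeasure s delta F = 0%E.
Proof.
move=> FG G0; apply/eqP; rewrite eq_le hausdorff_premeasure_ge0 andbT.
have mu0 := @power_diam_ge0 R s delta.
rewrite hausdorff_premeasureE in G0 *.
apply: (@le_trans _ _ _ _ _
  (@le_mu_ext _ (g_sigma_algebraType setT) _ _ _ _ FG)).
have := @mu_ext_sigma_subadditive _ (g_sigma_algebraType setT) _ _ mu0 G.
by rewrite eseries0.
Qed.

Lemma hausdorff_premeasure_le_cover (R : realType) (s delta e : R) (F : set R)
    (n : nat) : 0 <= s -> e <= delta -> coverable e F n ->
  (hausdorff_premeasure s delta F <= (n%:R * e `^ s)%:E)%E.
Proof.
move=> s0 edelta [U [dU FU]]; rewrite hausdorff_premeasureE.
pose V (i : nat) := if insub i is Some j then U j else set0.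
have V0 i : (n <= i)%N -> V i = set0.
  by move=> ni; rewrite /V insubF// ltnNge ni.
apply: ge_ereal_inf; exists (\sum_(0 <= i <oo) power_diam s delta (V i))%E.
  exists V => //; split=> [i|x Fx]; first exact: sub_sigma_algebra.
  by have [i _ Uix] := FU x Fx; exists (val i) => //; rewrite /V valK.
rewrite (@nneseries_split _ _ 0 n); last by move=> *; exact: power_diam_ge0.
rewrite add0n [X in (_ + X)%E]eseries0 ?adde0; last first.
  by move=> i ni _; rewrite V0// /power_diam eqxx.
have -> : (n%:R * e `^ s)%:E = (\sum_(0 <= i < n) (e `^ s)%:E)%E.
  by rewrite sumEFin sumr_const_nat subn0 mulr_natl.
rewrite !big_mkord; apply: lee_sum => i _; rewrite /V valK /power_diam.
case: eqP => [_|/eqP/set0P U0]; first by rewrite lee_fin powR_ge0.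
rewrite (le_trans (dU i)) ?lee_fin// -poweR_EFin.
have d0 := diam_ge0 U0.
by apply: gt0_ler_poweR => //; rewrite in_itv/= leey andbT// (le_trans d0).
Qed.

(** For lower box dimension < t < s there are arbitrarily small e for which at
    most e^(-t) sets of diameter e suffice, with total contribution
    e^(s - t). *)
Lemma hausdorff_premeasure_eq0 (R : realType) (s delta : R) (F : set R) :
  0 < s -> 0 < delta -> bounded_set F -> (lower_box_dim F < s%:E)%E ->
  hausdorff_premeasure s delta F = 0%E.
Proof.
move=> s0 delta0 bF Fs.
have [t [t0 ts Ft]] : exists t, [/\ 0 <= t, t < s & (lower_box_dim F < t%:E)%E].
  move: Fs (lower_box_dim_ge0 F); case: (lower_box_dim F) => // l.
  rewrite lte_fin lee_fin.
  by move=> ls l0; exists ((l + s) / 2); rewrite lte_fin; split; lra.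
apply/eqP; rewrite eq_le hausdorff_premeasure_ge0 andbT.
apply/lee_addgt0Pr => h h0; rewrite add0e.
pose eta := Num.min (Num.min delta 1) (expR (ln h / (s - t))).
(* The third bound on e makes e^(s - t) at most h; e < 1 gives ln e < 0. *)
have eta0 : 0 < eta by rewrite !lt_min delta0 ltr01 expR_gt0.
have [e /andP[e0]] := lower_box_dim_lt Ft eta0.
rewrite !lt_min => /andP[/andP[edelta e1] eh].
set N := covering_number e F => Nt.
have NF : coverable e F N.
  exact/coverable_covering_number/coverable_bounded.
rewrite (le_trans (hausdorff_premeasure_le_cover (ltW s0) (ltW edelta) NF))//.
have [->|N0] := posnP N; first by rewrite mul0r lee_fin ltW.
have lne : ln e < 0 by rewrite ln_lt0// e0.
rewrite lee_fin -[N%:R]lnK ?posrE ?ltr0n// /powR gt_eqF// -expRD.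
rewrite -[leRHS]lnK ?posrE// ler_expR.
move: Nt; rewrite ltr_pdivrMr ?oppr_gt0// => Nt.
have : ln e < ln h / (s - t) by rewrite -[ltRHS]expRK ltr_ln ?posrE ?expR_gt0.
rewrite ltr_pdivlMr ?subr_gt0// => eh'.
nra.
Qed.

Lemma hausdorff_dim_le (R : realType) (F : set R) (t : R) : 0 <= t ->
  (forall s, t < s -> hausdorff_measure s F = 0%E) ->
  (hausdorff_dim F <= t%:E)%E.
Proof.
move=> t0 H; apply/lee_addgt0Pr => h h0; apply: ereal_inf_lbound.
by exists (t + h) => //; split; [lra|apply: H; lra].
Qed.

Theorem hausdorff_dim_le_modified_lower_box_dim (R : realType) (F : set R) :
  (hausdorff_dim F <= modified_lower_box_dim F)%E.
Proof.
apply: le_ereal_inf_tmp => _ [G [GP FG] <-].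
set t := ereal_sup _.
have Gt i : (lower_box_dim (G i) <= t)%E by apply: ereal_sup_ubound; exists i.
have := le_trans (lower_box_dim_ge0 (G 0%N)) (Gt 0%N).
case: t Gt => [t Gt|_ _|_ //]; last by rewrite leey.
rewrite lee_fin => t0; apply: hausdorff_dim_le => // s ts.
apply/eqP; rewrite eq_le; apply/andP; split; last first.
  apply: le_ereal_sup_tmp; exists (hausdorff_premeasure s 1 F).
    by exists 1 => /=.
  exact: hausdorff_premeasure_ge0.
apply: ge_ereal_sup => _ [delta /= delta0 <-].
rewrite (hausdorff_premeasure_bigcup_eq0 FG)// => i.
apply: hausdorff_premeasure_eq0 => //; first lra; first exact: (GP i).2.
by rewrite (le_lt_trans (Gt i))// lte_fin.
Qed.

(** * Counting the intervals at each level *)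

Definition scale (D M : nat -> nat) (k : nat) : nat :=
  \prod_(i < k) (2 * M i * D i).

Definition digit_count (D : nat -> nat) (k : nat) : nat := \prod_(i < k) D i.

Lemma scaleS (D M : nat -> nat) (k : nat) :
  scale D M k.+1 = (scale D M k * (2 * M k * D k))%N.
Proof. by rewrite /scale big_ord_recr. Qed.

Lemma digit_countS (D : nat -> nat) (k : nat) :
  digit_count D k.+1 = (digit_count D k * D k)%N.
Proof. by rewrite /digit_count big_ord_recr. Qed.

Lemma scale_gt (D M : nat -> nat) (k : nat) :
  (forall k, 0 < D k)%N -> (forall k, 0 < M k)%N -> (k < scale D M k)%N.
Proof.
move=> D0 M0; elim: k => [|k IH]; first by rewrite /scale big_ord0.
have : (1 < 2 * M k * D k)%N by have := D0 k; have := M0 k; nia.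
by rewrite scaleS; nia.
Qed.

Lemma digit_count_gt0 (D : nat -> nat) (k : nat) :
  (forall k, 0 < D k)%N -> (0 < digit_count D k)%N.
Proof. by move=> D0; rewrite prodn_gt0. Qed.

(** Near a centre t of level k the admissible centres p / (L q_(k+1)) of level
    k + 1 satisfy |p - t L q_(k+1)| <= c + c B_k / M_k <= 3 c D_k, which leaves
    O(D_k) of them. *)
Lemma near_multiples_net (R : realType) (D M : nat -> nat) (L c A k : nat) :
  (forall k, 0 < D k)%N -> (forall k, 0 < M k)%N -> (0 < L)%N -> (0 < c)%N ->
  exists s : seq R,
    (size s <= (2 * (L * A + c)).+1 * (6 * c).+1 ^ k * digit_count D k)%N /\
    forall x, near_multiples_set (scale D M) M L c A x ->
      exists2 t, t \in s & `|x - t| <= c%:R / (L * scale D M k * M k)%:R.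
Proof.
move=> D0 M0 L0 c0.
have q0 j : (0 < L * scale D M j)%N.
  by rewrite muln_gt0 L0/= (leq_ltn_trans _ (scale_gt j D0 M0)).
have q0' j : 0 < (L * scale D M j)%:R :> R by rewrite ltr0n.
have M0' j : 0 < (M j)%:R :> R by rewrite ltr0n.
have centre j (x : R) (p : int) :
    `|(L * scale D M j)%:R * x - p%:~R| <= c%:R / (M j)%:R ->
    `|x - p%:~R / (L * scale D M j)%:R| <= c%:R / (L * scale D M j * M j)%:R.
  rewrite [(_ * M j)%:R]natrM; have := q0' j; set q := (L * _)%:R => q1 xp.
  clearbody q.
  have -> : x - p%:~R / q = (q * x - p%:~R) / q by field; rewrite gt_eqF.
  rewrite normrM normfV [`|q|]gtr0_norm// ler_pdivrMr// (le_trans xp)//.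
  by rewrite le_eqVlt; apply/orP; left; apply/eqP; field; rewrite !gt_eqF.
elim: k => [|k [s [sz net]]].
  exists [seq p%:~R / (L * scale D M 0)%:R : R
    | p <- ints_around (0 : R) (L * A + c)]; split.
    by rewrite size_map size_ints_around /digit_count big_ord0 !muln1.
  move=> x [xA xnear]; have [p xp] := xnear 0%N.
  exists (p%:~R / (L * scale D M 0)%:R); last exact: centre.
  apply/mapP; exists p => //; apply: mem_ints_around; rewrite subr0.
  have -> : p%:~R =
      (L * scale D M 0)%:R * x - ((L * scale D M 0)%:R * x - p%:~R).
    by ring.
  rewrite (le_trans (ler_normB _ _))// natrD lerD//.
    rewrite /scale big_ord0 muln1 normrM normr_nat natrM ler_wpM2l//.
  by rewrite (le_trans xp)// ler_pdivrMr// ler_peMr// ler1n.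
exists [seq p%:~R / (L * scale D M k.+1)%:R : R
  | t <- s, p <- ints_around (t * (L * scale D M k.+1)%:R) (3 * c * D k)].
split.
  rewrite size_allpairs_dep; under eq_map do rewrite size_ints_around.
  have -> : sumn [seq (2 * (3 * c * D k)).+1 | _ <- s] =
      (size s * (2 * (3 * c * D k)).+1)%N.
    by elim: (s) => //= _ s' ->; rewrite mulSn.
  rewrite digit_countS expnSr.
  rewrite (leq_trans (leq_mul sz (_ : _ <= (6 * c).+1 * D k)%N))//.
    have := D0 k; nia.
  by apply/eq_leq; ring.
move=> x xG; have [t ts xt] := net x xG; have [xA xnear] := xG.
have [p xp] := xnear k.+1.
exists (p%:~R / (L * scale D M k.+1)%:R); last exact: centre.
apply/allpairsPdep; exists t, p; split=> //; apply: mem_ints_around.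
have -> : p%:~R - t * (L * scale D M k.+1)%:R =
    (x - t) * (L * scale D M k.+1)%:R
    - ((L * scale D M k.+1)%:R * x - p%:~R) by ring.
rewrite (le_trans (ler_normB _ _))//.
have -> : (3 * c * D k)%:R = 2 * c%:R * (D k)%:R + c%:R * (D k)%:R :> R.
  by rewrite !natrM; ring.
apply: lerD; last first.
  rewrite (le_trans xp)// ler_pdivrMr// -mulrA ler_peMr// -natrM ler1n.
  by rewrite muln_gt0 D0 M0.
rewrite normrM normr_nat.
rewrite (le_trans (ler_wpM2r (ler0n _ _) xt))// scaleS.
rewrite [X in X <= _](_ : _ = 2 * c%:R * (D k)%:R)// !natrM.
have : 0 < (L * scale D M k)%:R :> R by exact: q0'.
rewrite natrM => /gt_eqF; rewrite mulf_eq0 => /negbT.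
rewrite negb_or => /andP[? ?].
by field; rewrite gt_eqF//=; apply/andP.
Qed.

Lemma covering_number_near_multiples (R : realType) (D M : nat -> nat)
    (L c A k : nat) :
  (forall k, 0 < D k)%N -> (forall k, 0 < M k)%N -> (0 < L)%N -> (0 < c)%N ->
  (covering_number ((2 * c)%:R / (scale D M k)%:R)
     (near_multiples_set (scale D M) M L c A : set R)
   <= (2 * (L * A + c)).+1 * (6 * c).+1 ^ k * digit_count D k)%N.
Proof.
move=> D0 M0 L0 c0; have [s [sz net]] := near_multiples_net R A k D0 M0 L0 c0.
apply: leq_trans sz; apply: covering_number_le.
apply: coverable_near_seq => x xG.
have [t ts xt] := net x xG; exists t => //; apply: (le_trans xt).
have q0 : 0 < (scale D M k)%:R :> R.
  by rewrite ltr0n (leq_ltn_trans _ (scale_gt k D0 M0)).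
have -> : (2 * c)%:R / (scale D M k)%:R / 2 = c%:R / (scale D M k)%:R :> R.
  by rewrite natrM; field; rewrite gt_eqF.
rewrite ler_wpM2l// lef_pV2 ?posrE ?ltr0n ?muln_gt0 ?L0 ?M0 -?(ltr0n R) ?q0//.
rewrite ler_nat mulnAC leq_pmull//.
by rewrite muln_gt0 L0 M0.
Qed.

(** * A Cantor set of points with non-dense multiples *)

(** A cover of F by sets U_i pulls back to a cover of [0, 1[ by sets of
    diameter at most K (diam U_i)^s, whose lengths have sum at least 1. *)
Lemma hausdorff_measure_neq0 (R : realType) (F : set R) (psi : R -> R)
    (s K : R) :
  0 < K -> (forall y : R, 0 <= y < 1 -> F (psi y)) ->
  (forall y z : R, 0 <= y < 1 -> 0 <= z < 1 ->
     `|y - z| <= K * `|psi y - psi z| `^ s) ->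
  0 <= s -> hausdorff_measure s F != 0%E.
Proof.
move=> K0 Fpsi psiK s0; rewrite gt_eqF//.
have K2 : 0 < 2 * K by lra.
apply: (@lt_le_trans _ _ ((2 * K)^-1)%:E); first by rewrite lte_fin invr_gt0.
apply: le_ereal_sup_tmp; exists (hausdorff_premeasure s 1 F).
  by exists 1 => /=.
apply: le_ereal_inf_tmp => _ [U [dU FU] <-].
rewrite eseries_mkcond.
set mass := fun i => if U i != set0 then poweR (diam (U i)) s else 0%E.
have mass0 i : (0 <= mass i)%E.
  by rewrite /mass; case: ifP => // _; exact: poweR_ge0.
have /choice[I HI] : forall i, exists I : set R, [/\ measurable I,
    (lebesgue_measure I <= (2 * K)%:E * mass i)%E &
    forall y : R, 0 <= y < 1 -> U i (psi y) -> I y].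
  move=> i.
  have [[z [z01 Uz]]|none] :=
    pselect (exists z : R, 0 <= z < 1 /\ U i (psi z)).
    have U0 : U i !=set0 by exists (psi z).
    have [r r0 rE] : exists2 r : R, 0 <= r & diam (U i) = r%:E.
      move: (diam_ge0 U0) (dU i); case: (diam (U i)) => // r r0 _; by exists r.
    exists `[z - K * r `^ s, z + K * r `^ s]%classic; split=> // [|y y01 Uy].
      rewrite lebesgue_measure_itv /= /mass ((set0P _).2 U0) rE poweR_EFin.
      rewrite lte_fin -EFinM; case: ifP => _.
        by rewrite -EFinD lee_fin; lra.
      by rewrite lee_fin mulr_ge0 ?powR_ge0// ltW.
    rewrite /= in_itv /= -ler_distlC.
    rewrite (le_trans (psiK _ _ z01 y01))// ler_pM2l// ge0_ler_powR ?nnegrE//.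
    by rewrite -lee_fin -rE; exact: dist_le_diam.
  exists set0; split=> // [|y y01 Uy]; last by apply: none; exists y.
  by rewrite measure0 mule_ge0 ?lee_fin ?mass0// ltW.
have cover : `[(0:R), 1[%classic `<=` \bigcup_i I i.
  move=> y; rewrite /= in_itv/= => y01.
  have [i _ Ui] := FU _ (Fpsi y y01); exists i => //.
  by have [_ _] := HI i; apply.
have l01 : lebesgue_measure (`[(0:R), 1[%classic : set R) = 1%E.
  by rewrite lebesgue_measure_itv /= lte_fin ltr01 -EFinB subr0.
have leI : (1 <= \sum_(0 <= i <oo) lebesgue_measure (I i))%E.
  by rewrite -l01; apply: measure_sigma_subadditive => // i; have [] := HI i.
have {}leI : (1 <= (2 * K)%:E * \sum_(0 <= i <oo) mass i)%E.
  rewrite -nneseriesZl//; apply: (le_trans leI); apply: lee_nneseries => // i _.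
  by have [] := HI i.
rewrite -(@lee_pmul2l _ (2 * K)%:E) ?lte_fin//.
by rewrite -EFinM mulfV// gt_eqF.
Qed.

Definition cell (R : realType) (D : nat -> nat) (k : nat) (y : R) : nat :=
  Num.truncn ((digit_count D k)%:R * y).

(** The digit appended at level j is the position of the cell of y of level
    j + 1 among the D_j cells into which its cell of level j splits, so
    that only the D_j smallest of the 2 M_j D_j possible digits occur. *)
Fixpoint cantor_num (R : realType) (D M : nat -> nat) (k : nat) (y : R) : nat :=
  if k is j.+1 then
    (cantor_num D M j y * (2 * M j * D j) + cell D j.+1 y %% D j)%N
  else 0%N.

(** The number whose digits in the radices 2 M_k D_k are the digits of y in the
    radices D_k, as the supremum of its truncations. *)
Definition cantor_map (R : realType) (D M : nat -> nat) (y : R) : R :=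
  sup (range (fun k => (cantor_num D M k y)%:R / (scale D M k)%:R)).

Lemma cellS_div (R : realType) (D : nat -> nat) (k : nat) (y : R) :
  (0 < D k)%N -> 0 <= y -> (cell D k.+1 y %/ D k)%N = cell D k y.
Proof.
move=> D0 y0; rewrite /cell digit_countS; set x := (digit_count D k)%:R * y.
rewrite natrM mulrAC -/x; apply/esym/truncn_def.
have D0' : 0 < (D k)%:R :> R by rewrite ltr0n.
have x0 : 0 <= x * (D k)%:R by rewrite !mulr_ge0.
have := truncn_itv x0; set a := Num.truncn _ => /andP[a1 a2].
rewrite -(ler_pM2r D0') -(ltr_pM2r D0') -!natrM; apply/andP; split.
  by rewrite (le_trans _ a1)// ler_nat leq_trunc_div.
by rewrite (lt_le_trans a2)// ler_nat -ltn_divLR.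
Qed.

Section CantorMap.
Context {R : realType} {D M : nat -> nat}.
Hypotheses (D0 : forall k, (0 < D k)%N) (M0 : forall k, (0 < M k)%N).

Let lo k (y : R) : R := (cantor_num D M k y)%:R / (scale D M k)%:R.
Let hi k (y : R) : R :=
  ((cantor_num D M k y)%:R + (2 * M k)%:R^-1) / (scale D M k)%:R.

Let q0 k : 0 < (scale D M k)%:R :> R.
Proof. by rewrite ltr0n (leq_ltn_trans _ (scale_gt k D0 M0)). Qed.

Let Mgt0 k : 0 < (M k)%:R :> R. Proof. by rewrite ltr0n. Qed.
Let Dgt0 k : 0 < (D k)%:R :> R. Proof. by rewrite ltr0n. Qed.

Let lo_nondecreasing y : {homo lo^~ y : j k / (j <= k)%N >-> j <= k}.
Proof.
apply: homo_leq => // [? ? ?|k]; first exact: le_trans.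
rewrite -[_ <= _]/(lo k y <= lo k.+1 y) /lo ler_pdivrMr// mulrAC.
rewrite ler_pdivlMr// -!natrM ler_nat scaleS /=.
by rewrite mulnCA (mulnC (_ + _)%N) leq_mul2l mulnC leq_addr orbT.
Qed.

Let hi_nonincreasing y : {homo hi^~ y : j k / (j <= k)%N >-> k <= j}.
Proof.
apply: homo_leq => // [? ? ? h1 h2|k]; first exact: le_trans h2 h1.
rewrite -[_ <= _]/(hi k.+1 y <= hi k y) /hi scaleS.
rewrite [(scale D M k * _)%:R]natrM invfM mulrCA [leRHS]mulrC.
rewrite ler_pM2l ?invr_gt0// ler_pdivrMr ?ltr0n ?muln_gt0 ?D0 ?M0//=.
have -> : ((cantor_num D M k y)%:R + (2 * M k)%:R^-1) * (2 * M k * D k)%:R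
    = (cantor_num D M k y * (2 * M k * D k))%:R + (D k)%:R :> R.
  by rewrite !natrM; field; rewrite gt_eqF.
rewrite natrD -addrA lerD2l.
have h : (cell D k.+1 y %% D k)%:R + 1 <= (D k)%:R :> R.
  by rewrite natr1 ler_nat ltn_pmod.
rewrite (le_trans _ h)// lerD2l invf_le1 ?ltr0n ?muln_gt0 ?M0//.
by rewrite ler1n muln_gt0 M0.
Qed.

(** The intervals [lo k y, hi k y] are nested: the largest digit is D_k - 1, and
    (D_k - 1 + 1/2) / (2 M_k D_k) < 1 / (2 M_k). *)
Lemma cantor_map_itv k (y : R) : lo k y <= cantor_map D M y <= hi k y.
Proof.
have lohi j : lo j y <= hi j y.
  by rewrite ler_pM2r ?invr_gt0// lerDl invr_ge0.
have ub : ubound (range (lo^~ y)) (hi k y).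
  move=> _ [j _ <-].
  rewrite (le_trans (lo_nondecreasing y (leq_maxl j k)))//.
  rewrite (le_trans (lohi _))//.
  exact/hi_nonincreasing/leq_maxr.
apply/andP; split; last by apply: ge_sup => //; exists (lo 0%N y), 0%N.
by apply: ub_le_sup; [exists (hi k y)|exists k].
Qed.

Lemma cantor_map_near_int k (y : R) :
  exists p : int, 0 <= (scale D M k)%:R * cantor_map D M y - p%:~R
                    <= (2 * M k)%:R^-1.
Proof.
exists (cantor_num D M k y)%:Z; have /andP[] := cantor_map_itv k y.
rewrite /lo /hi ler_pdivrMr// ler_pdivlMr// -pmulrn => ? ?.
by apply/andP; split; lra.
Qed.

(** The truncations of level k differ by at least 1 / q_k, and the remaining
    digits contribute at most half of that because 1 / (2 M_k) <= 1/2. *)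
Lemma cantor_map_gap k (y z : R) :
  (cantor_num D M k y < cantor_num D M k z)%N ->
  (2 * scale D M k)%:R^-1 <= cantor_map D M z - cantor_map D M y.
Proof.
move=> yz; have /andP[_] := cantor_map_itv k y.
have /andP[+ _] := cantor_map_itv k z.
rewrite /lo /hi ler_pdivrMr// ler_pdivlMr// => hz hy.
have half : (2 * M k)%:R^-1 <= 2^-1 :> R.
  by rewrite lef_pV2 ?posrE ?ltr0n ?muln_gt0 ?M0// ler_nat leq_pmulr.
have : (cantor_num D M k y)%:R + 1 <= (cantor_num D M k z)%:R :> R.
  by rewrite natr1 ler_nat.
rewrite natrM invfM ler_pdivrMr//; lra.
Qed.

Lemma eq_cantor_num k (y z : R) :
  (forall j, (j <= k)%N -> cell D j y = cell D j z) ->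
  cantor_num D M k y = cantor_num D M k z.
Proof.
elim: k => //= k IH eqc; rewrite IH => [|j jk]; last by apply: eqc; lia.
by rewrite eqc.
Qed.

Lemma dist_le_of_eq_cell k (y z : R) : 0 <= y -> 0 <= z ->
  cell D k y = cell D k z -> `|y - z| <= (digit_count D k)%:R^-1.
Proof.
move=> y0 z0; rewrite /cell.
have P0 : 0 < (digit_count D k)%:R :> R by rewrite ltr0n digit_count_gt0.
have := truncn_itv (mulr_ge0 (ltW P0) y0).
have := truncn_itv (mulr_ge0 (ltW P0) z0).
move=> + + yz; rewrite -yz -natr1 => /andP[? ?] /andP[? ?].
rewrite -[_^-1]mul1r ler_pdivlMr// -[X in _ * X]gtr0_norm// -normrM ler_norml.
by apply/andP; split; lra.
Qed.

(** The level k is the last one at which y and z share a cell. *)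
Lemma cantor_map_separates (y z : R) :
  (forall A, exists k, (A < digit_count D k)%N) ->
  0 <= y < 1 -> 0 <= z < 1 -> y != z ->
  exists k, `|y - z| <= (digit_count D k)%:R^-1 /\
    (2 * scale D M k.+1)%:R^-1 <= `|cantor_map D M y - cantor_map D M z|.
Proof.
move=> Punb /andP[y0 y1] /andP[z0 z1] yz.
have ex : exists k, cell D k y != cell D k z.
  have [k kP] := Punb (Num.truncn (`|y - z|^-1)); exists k; apply/eqP.
  move=> /(dist_le_of_eq_cell y0 z0); apply/negP; rewrite -ltNge.
  rewrite invf_plt ?posrE ?normr_gt0 ?subr_eq0 ?ltr0n ?digit_count_gt0//.
  by rewrite (lt_le_trans (truncnS_gt _))// ler_nat.
case: (ex_minnP ex) => -[|k] neq min.
  move: neq; rewrite /cell /digit_count big_ord0 !mul1r.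
  by rewrite !(@truncn_def _ _ 0%N) ?eqxx// ?y0 ?z0.
have eqc j : (j <= k)%N -> cell D j y = cell D j z.
  by move=> jk; apply/eqP/negPn/negP => /min; lia.
exists k; split; first exact/dist_le_of_eq_cell/eqc.
have : cantor_num D M k.+1 y != cantor_num D M k.+1 z.
  rewrite /= (eq_cantor_num eqc) eqn_add2l; apply: contraNneq neq => eqm.
  by rewrite (divn_eq (cell D k.+1 y) (D k)) eqm !cellS_div// eqc//
    -(cellS_div (y:=z))// -divn_eq.
rewrite neq_ltn => /orP[] lt; rewrite ler_normr; apply/orP.
  by right; rewrite opprB; exact: cantor_map_gap.
by left; exact: cantor_map_gap.
Qed.

End CantorMap.

(** * The parameters giving dimension d *)

Section DyadicParameters.
Context {R : realType} (d : R).
Hypothesis (d01 : 0 <= d <= 1).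

Let f (j : nat) : nat := Num.truncn (d * j%:R).
(** The radix 2 * multipliers j * free_digits j equals 2 ^ j.+1: a block of
    j + 1 binary digits, of which about d j are free. *)
Definition free_digits (j : nat) : nat := 2 ^ f j.
Definition multipliers (j : nat) : nat := 2 ^ (j - f j).

Let d0 : 0 <= d. Proof. by case/andP: d01. Qed.

Let f_itv j : d * j%:R - 1 < (f j)%:R /\ (f j)%:R <= d * j%:R.
Proof.
have /andP[? h] := truncn_itv (mulr_ge0 d0 (ler0n R j)).
by split=> //; rewrite ltrBlDr natr1.
Qed.

Let fj j : (f j <= j)%N.
Proof.
rewrite -(ler_nat R) (le_trans (f_itv j).2)// ler_piMl//.
by case/andP: d01.
Qed.

Lemma free_digits_gt0 j : (0 < free_digits j)%N.
Proof. by rewrite expn_gt0. Qed.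

Lemma multipliers_gt0 j : (0 < multipliers j)%N.
Proof. by rewrite expn_gt0. Qed.

Local Notation q := (scale free_digits multipliers).
Local Notation P := (digit_count free_digits).
Let n (k : nat) : nat := \sum_(j < k) j.+1.
Let F (k : nat) : nat := \sum_(j < k) f j.

Let scaleE k : q k = (2 ^ n k)%N.
Proof.
elim: k => [|k IH]; first by rewrite /scale /n !big_ord0.
rewrite scaleS IH /n big_ord_recr /= expnD /free_digits /multipliers.
by rewrite -mulnA -expnD subnK// -expnS.
Qed.

Let digit_countE k : P k = (2 ^ F k)%N.
Proof.
elim: k => [|k IH]; first by rewrite /digit_count /F !big_ord0.
by rewrite digit_countS IH /F big_ord_recr /= expnD.
Qed.

Let nE k : (n k)%:R = k%:R * (k%:R + 1) / 2 :> R.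
Proof.
elim: k => [|k IH]; first by rewrite /n big_ord0 mul0r mul0r.
by rewrite /n big_ord_recr natrD -/(n k) IH /= -natr1; field.
Qed.

Let F_le k : (F k)%:R <= d * (k%:R * (k%:R - 1) / 2).
Proof.
elim: k => [|k IH]; first by rewrite /F big_ord0 !mul0r mulr0.
rewrite /F big_ord_recr natrD -/(F k) /= -natr1.
by have := (f_itv k).2; lra.
Qed.

Let F_ge k : d * (k%:R * (k%:R - 1) / 2) - k%:R <= (F k)%:R.
Proof.
elim: k => [|k IH]; first by rewrite /F big_ord0 !mul0r mulr0 subr0.
rewrite /F big_ord_recr natrD -/(F k) /= -natr1.
by have := (f_itv k).1; lra.
Qed.

Lemma digit_count_unbounded : 0 < d -> forall A, exists k, (A < P k)%N.
Proof.
move=> dgt0 A; pose k := (A + (Num.truncn (4 / d)).+2)%N; exists k.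
rewrite digit_countE (leq_ltn_trans _ (ltn_expl _ _))// -(ler_nat R).
apply: le_trans (F_ge k).
have kA : A%:R <= k%:R :> R by rewrite ler_nat leq_addr.
have : 4 / d <= k%:R - 1.
  rewrite lerBrDr (le_trans (_ : _ <= (Num.truncn (4 / d)).+2%:R))//.
    by rewrite -[in leRHS]natr1 lerD2r ltW// truncnS_gt.
  by rewrite ler_nat leq_addl.
rewrite ler_pdivrMr// => kd; have k0 : 0 <= k%:R :> R by rewrite ler0n.
by apply: (le_trans kA); nra.
Qed.

(** On the logarithmic scale the difference of the two sides is at most a
    quadratic polynomial in k with leading coefficient (s - d) / 2 < 0. *)
Lemma digit_count_ge (s : R) : 0 <= s < d ->
  exists2 K : R, 0 < K &
    forall k, (P k)%:R^-1 <= K * ((2 * q k.+1)%:R^-1) `^ s.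
Proof.
move=> /andP[s0 sd].
pose e := (d - s) / 2; pose b := (3 * s + d) / 2 + 1.
have e0 : 0 < e by rewrite /e; lra.
(* 2 s + b t - e t^2 is the quadratic polynomial in t = k, and b^2 / (4 e) is
   the maximum of b t - e t^2. *)
pose C := 2 * s + b ^+ 2 / (4 * e).
exists (2 `^ C) => [|k]; first exact: powR_gt0.
rewrite digit_countE scaleE -expnS !natrX -!powR_mulrn// -!powRN -powRrM.
rewrite -powRD; last by rewrite pnatr_eq0 implybT.
apply: ler_powR; first by rewrite ler1n.
rewrite -natr1 nE -natr1; have := F_ge k; set t := k%:R => Fk.
have sq : b * t - e * t ^+ 2 <= b ^+ 2 / (4 * e).
  rewrite ler_pdivlMr; last by lra.
  by have := sqr_ge0 (b - 2 * e * t); lra.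
rewrite /C; apply: le_trans (_ : - (d * (t * (t - 1) / 2) - t) <= _).
  by rewrite lerN2.
rewrite -subr_ge0 in sq; rewrite -subr_ge0; apply: (le_trans sq).
by rewrite /b /e; lra.
Qed.

(** At the scale 2 c / q_k the logarithm of the covering number is at most
    d (ln 2) k^2 / 2 + O(k), and -ln (2 c / q_k) is (ln 2) k^2 / 2 + O(k). *)
Lemma lower_box_dim_near_multiples (L c A : nat) : (0 < L)%N -> (0 < c)%N ->
  forall s : R, d < s ->
  (lower_box_dim (near_multiples_set q multipliers L c A : set R) <= s%:E)%E.
Proof.
move=> L0 c0 s ds; apply: lower_box_dim_le => eta eta0.
pose A0 := (2 * (L * A + c)).+1; pose K := (6 * c).+1.
have ln20 : 0 < ln 2 :> R by rewrite ln_gt0// ltr1n.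
(* What has to be shown reduces to a + b k <= e k^2. *)
pose a : R := ln A0%:R + s * ln (2 * c)%:R; pose b : R := ln K%:R.
pose e : R := (s - d) * ln 2 / 2.
have e0 : 0 < e by rewrite /e; nra.
pose m := Num.min eta 1.
have m0 : 0 < m by rewrite lt_min eta0 ltr01.
pose k := (Num.truncn ((`|a| + `|b|) / e) + Num.truncn ((2 * c)%:R / m)).+1.
have ke : (`|a| + `|b|) <= k%:R * e.
  rewrite -ler_pdivrMr// (le_trans (ltW (truncnS_gt _)))// ler_nat ltnS.
  exact: leq_addr.
have km : (2 * c)%:R < k%:R * m.
  rewrite -ltr_pdivrMr// (lt_le_trans (truncnS_gt _))// ler_nat ltnS.
  exact: leq_addl.
have qk := scale_gt k free_digits_gt0 multipliers_gt0.
have q0 : 0 < (q k)%:R :> R by rewrite ltr0n (leq_ltn_trans _ qk).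
have c20 : 0 < (2 * c)%:R :> R by rewrite ltr0n muln_gt0.
have em : (2 * c)%:R / (q k)%:R < m.
  rewrite ltr_pdivrMr// mulrC (lt_le_trans km)// ler_wpM2r ?(ltW m0)// ler_nat.
  exact: ltnW.
exists ((2 * c)%:R / (q k)%:R).
  by rewrite divr_gt0//= (lt_le_trans em)// ge_min lexx.
have lne : ln ((2 * c)%:R / (q k)%:R) = ln (2 * c)%:R - (n k)%:R * ln 2 :> R.
  by rewrite ln_div ?posrE// scaleE natrX lnXn ?ltr0n// mulr_natl.
have lne0 : ln ((2 * c)%:R / (q k)%:R) < 0 :> R.
  by rewrite ln_lt0// divr_gt0//= (lt_le_trans em)// ge_min lexx orbT.
have := covering_number_near_multiples R A k
  free_digits_gt0 multipliers_gt0 L0 c0.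
rewrite -/A0 -/K; set N := covering_number _ _ => NB.
have lnN : ln N%:R <= ln A0%:R + k%:R * b + (F k)%:R * ln 2 :> R.
  have -> : ln A0%:R + k%:R * b + (F k)%:R * ln 2 = ln (A0 * K ^ k * P k)%:R.
    rewrite digit_countE !natrM !natrX !lnM ?lnXn ?posrE ?mulr_gt0
      ?exprn_gt0 ?ltr0n//.
    by rewrite !mulr_natl.
  have [->|N0] := posnP N.
    by rewrite ln0// ln_ge0// ler1n !muln_gt0 expn_gt0 digit_count_gt0// => ?;
      exact: free_digits_gt0.
  by rewrite ler_ln ?posrE ?ltr0n ?(leq_trans N0)// ler_nat.
rewrite ler_pdivrMr ?oppr_gt0// (le_trans lnN)//.
rewrite lne; have := F_le k; rewrite nE; move: ke; set t := k%:R => ke Fk.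
have t1 : 1 <= t by rewrite ler1n.
have ab : a + t * b <= t * (t * e).
  rewrite (le_trans (_ : _ <= t * (`|a| + `|b|)))//;
    last by rewrite ler_wpM2l//; lra.
  rewrite mulrDr lerD// ?(le_trans (ler_norm a))//; first by rewrite ler_peMl.
  by rewrite ler_wpM2l ?ler_norm//; lra.
have Fd : (F k)%:R * ln 2 <= d * (t * (t + 1) / 2) * ln 2.
  rewrite ler_wpM2r ?(ltW ln20)// (le_trans Fk)// ler_wpM2l//; lra.
have st : 0 <= t * (s - d) * ln 2 by rewrite !mulr_ge0//; lra.
move: ab; rewrite /a /e; lra.
Qed.

End DyadicParameters.

Unset Implicit Arguments.

Theorem theorem2p1 (R : realType) (d : R) (hd : 0 <= d <= 1) :
  exists r : nat -> nat,
    [/\ (forall n, (0 < r n)%N),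
        (r n)%:R @[n --> \oo] --> (+oo : set_system R),
        hausdorff_dim (nondense_set (fun n => (r n)%:R : R)) = d%:E &
        modified_lower_box_dim (nondense_set (fun n => (r n)%:R : R)) = d%:E].
Proof.
pose D := free_digits d; pose M := multipliers d; pose q := scale D M.
have D0 := free_digits_gt0 d; have M0 := multipliers_gt0 d.
have q_gt k : (k < q k)%N by exact: scale_gt.
pose r := multiples_seq q M; exists r.
set E := nondense_set _.
have lower : (d%:E <= hausdorff_dim E)%E.
  apply: le_ereal_inf_tmp => _ [s [s0 Hs] <-]; rewrite lee_fin leNgt.
  apply/negP => sd.
  have [|K K0 KP] := digit_count_ge hd (s := s); first by rewrite s0.
  have dgt0 := le_lt_trans s0 sd.
  have : hausdorff_measure s E != 0%E.
    apply: (@hausdorff_measure_neq0 _ _ (cantor_map D M) _ K) => //.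
      move=> y _; apply: nondense_multiples => // k.
      exact: cantor_map_near_int.
    move=> y z y01 z01; have [->|yz] := eqVneq y z.
      by rewrite subrr normr0 mulr_ge0 ?powR_ge0// ltW.
    have [k [close far]] := cantor_map_separates D0 M0
      (digit_count_unbounded hd dgt0) y01 z01 yz.
    rewrite (le_trans close)// (le_trans (KP k))// ler_pM2l//.
    by rewrite ge0_ler_powR// nnegrE// invr_ge0.
  by rewrite Hs eqxx.
have upper : (modified_lower_box_dim E <= d%:E)%E.
  apply/lee_addgt0Pr => h h0; apply: ge_ereal_inf.
  pose G i := near_multiples_set q M i.+1`! (i.+1`! * (2 * i.+1)) i.+1 : set R.
  exists (ereal_sup (range (fun i => lower_box_dim (G i)))).
    exists G => //; split=> [i|x Ex].
      split.
        exists 0; split=> [|k]; first by rewrite normr0.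
        by exists 0; rewrite mulr0 subr0 normr0 divr_ge0.
      exists i.+1%:R; split; first exact: num_real.
      by move=> x ix y [yi _]; exact: le_trans yi (ltW ix).
    by have [i Gi] := near_multiples_of_nondense M0 Ex; exists i.
  apply: ge_ereal_sup => _ [i _ <-]; rewrite -EFinD.
  apply: lower_box_dim_near_multiples => //; rewrite ?muln_gt0 ?fact_gt0//.
  by rewrite ltrDl.
have mid := hausdorff_dim_le_modified_lower_box_dim E.
split.
- move=> n; have [k [m [/andP[m0 _] rn]]] := multiples_seq_mem q n M0.
  by rewrite /r rn muln_gt0 m0 (leq_ltn_trans _ (q_gt k)).
- exact: multiples_seq_cvgy.
- by apply/eqP; rewrite eq_le lower andbT (le_trans mid).
- by apply/eqP; rewrite eq_le upper (le_trans lower).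
Qed.
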